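(* For every graph $G$ the following statements are equivalent: (i) $G$ is $\gamma_g$-perfect. (ii) $G$ is $2$-$\gamma_g$-perfect. (iii) $G$ can be obtained (up to isomorphism) from an isolated vertex $K_1$ by repeatedly applying (zero or more times) the following operators: - for a graph $F$ and a positive integer $s$, take the vertex-disjoint union $F\sqcup K_s$; - for a graph $F$ and a perfect set of cliques $\mathcal{Q}$ in $F$, take $\mathcal{O}(F,v,\mathcal{Q})$.
   Context: Graphs are finite, simple, undirected, with at least one vertex, not necessarily connected. $N_G(v)$ and $N_G[v]$ are the open and closed neighborhoods of $v$. $\gamma(G)$ is the domination number of $G$. Domination game on $G$: Dominator and Staller alternately select vertices; each selected vertex must dominate (i.e. contain in its closed neighborhood) at least one vertex not dominated by the previously selected vertices. The game ends when no legal move exists (all vertices are dominated). Dominator wants to minimize and Staller to maximize the total number of moves. $\gamma_g(G)$ is the number of moves under optimal play when Dominator starts. $G$ is $\gamma_g$-perfect if every induced subgraph $F$ of $G$ satisfies $\gamma_g(F)=\gamma(F)$. $G$ is $2$-$\gamma_g$-perfect if every induced subgraph $F$ of $G$ with $\gamma(F)=2$ satisfies $\gamma_g(F)=2$. For $S\subseteq V(G)$, $N_G'(S)=\bigl(\bigcup_{x\in S}N_G[x]\bigr)\setminus S$. A homogeneous clique in $G$ is a (nonempty) clique $Q\subseteq V(G)$ with $N_G[u]=N_G[w]$ for all $u,w\in Q$. The distance $d_G(Q,Q')$ between two vertex sets is the minimum of $d_G(x,x')$ over $x\in Q$, $x'\in Q'$ (vertices in different components are at infinite distance). A perfect set of cliques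 in $G$ is a (possibly empty) set $\mathcal{Q}$ of homogeneous cliques of $G$ such that for every two distinct $Q,Q'\in\mathcal{Q}$ we have $d_G(Q,Q')=3$ and every vertex of $N'_G(Q)$ is adjacent to every vertex of $N'_G(Q')$. In particular the empty set and any set consisting of a single homogeneous clique are perfect sets of cliques. Put $V(\mathcal{Q})=\bigcup_{Q\in\mathcal{Q}}Q$. For a graph $F$, a new vertex $v\notin V(F)$ and a perfect set of cliques $\mathcal{Q}$ in $F$, $\mathcal{O}(F,v,\mathcal{Q})$ is the graph obtained from $F$ by adding the vertex $v$ and making it adjacent to exactly the vertices of $V(F)\setminus V(\mathcal{Q})$. *)

(* Defs.v *)
From mathcomp Require Import all_boot.

Set Implicit Arguments.
Unset Strict Implicit.
Unset Printing Implicit Defensive.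

(* Finite simple undirected graphs. Nonemptiness of the vertex set is not part
   of the structure: it is a hypothesis wherever it is needed. *)
Record sgraph := SGraph {
  svertex :> finType;
  sedge : rel svertex;
  sedge_sym : symmetric sedge;
  sedge_irr : irreflexive sedge }.

Notation "x -- y" := (sedge x y) (at level 30).

Section Basic.
Variable G : sgraph.
Implicit Types (x y v w : G) (M S Q : {set G}).

Definition open_nbh v : {set G} := [set w | v -- w].
Definition closed_nbh v : {set G} := v |: open_nbh v.

Definition dominated M : {set G} := \bigcup_(v in M) closed_nbh v.
Definition dominating M : bool := dominated M == setT.

Definition domination_number : nat :=
  #|[arg min_(M < [set: G] | dominating M) #|M|]|.

(* M is the set of vertices selected so far. *)
Definition legal M v : bool := ~~ (closed_nbh v \subset dominated M).

(* Number of further moves under optimal play from position M, truncated to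
   fuel moves; dom tells whether Dominator moves next. Since the value is at
   most the fuel (see game_value_le), the default k of the minimum never
   influences it. *)
Fixpoint game_value (fuel : nat) (dom : bool) (M : {set G}) : nat :=
  if fuel is k.+1 then
    if [exists v, legal M v] then
      (if dom then \big[minn/k]_(v | legal M v) game_value k false (v |: M)
       else \max_(v | legal M v) game_value k true (v |: M)).+1
    else 0
  else 0.

(* Each legal move dominates a new vertex, so #|G| moves always suffice to end
   the game and the truncation is harmless (see game_value_stable). *)
Definition game_domination_number : nat := game_value #|G| true set0.

Definition homogeneous_clique Q : Prop :=
  [/\ Q != set0,
      {in Q &, forall u w, u != w -> u -- w} &
      {in Q &, forall u w, closed_nbh u = closed_nbh w}].

(* N'_G(S) *)
Definition outer_nbh S : {set G} := dominated S :\: S.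

(* d_G(x, y) = d and d_G(Q, Q') = d, as relations: they hold for no d when the
   distance is infinite. *)
Definition is_dist x y (d : nat) : Prop :=
  (exists p : seq G, [/\ path (@sedge G) x p, last x p = y & size p = d]) /\
  (forall p : seq G, path (@sedge G) x p -> last x p = y -> d <= size p).

Definition is_set_dist Q Q' (d : nat) : Prop :=
  (exists x y, [/\ x \in Q, y \in Q' & is_dist x y d]) /\
  (forall x y d', x \in Q -> y \in Q' -> is_dist x y d' -> d <= d').

Definition perfect_cliques (C : {set {set G}}) : Prop :=
  {in C, forall Q, homogeneous_clique Q} /\
  {in C &, forall Q Q', Q != Q' ->
     is_set_dist Q Q' 3 /\
     {in outer_nbh Q & outer_nbh Q', forall x y, x -- y}}.

Definition induced_rel S : rel {x | x \in S} := relpre val (@sedge G).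

Lemma induced_sym S : symmetric (@induced_rel S).
Proof. by move=> x y; exact: sedge_sym. Qed.

Lemma induced_irr S : irreflexive (@induced_rel S).
Proof. by move=> x; exact: sedge_irr. Qed.

Definition induced S : sgraph := SGraph (@induced_sym S) (@induced_irr S).

End Basic.

Section GameValue.
Variable G : sgraph.

Lemma game_value_le k b (M : {set G}) : game_value k b M <= k.
Proof.
elim: k b M => [|k IHk] b M //=; case: ifP => // _; rewrite ltnS.
case: b; last by apply/bigmax_leqP => v _; exact: IHk.
by elim/big_ind: _ => // m n m_le _; rewrite geq_min m_le.
Qed.

Lemma legal_card (M : {set G}) v :
  legal M v -> #|~: dominated (v |: M)| < #|~: dominated M|.
Proof.
case/subsetPn => u uv uM; apply/proper_card/properP; split.
  by rewrite setCS; apply/bigcupsP => w wM; apply: bigcup_sup; rewrite inE wM orbT.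
exists u; rewrite !inE ?uM // negbK; apply/bigcupP.
by exists v; rewrite // !inE eqxx.
Qed.

Lemma bigmin_default (P : pred G) (F : G -> nat) v0 n m :
  P v0 -> (forall v, F v <= n) -> (forall v, F v <= m) ->
  \big[minn/n]_(v | P v) F v = \big[minn/m]_(v | P v) F v.
Proof.
move=> Pv0; wlog suff le_nm : n m / (forall v, F v <= n) ->
    (forall v, F v <= m) ->
    \big[minn/n]_(v | P v) F v <= \big[minn/m]_(v | P v) F v.
  by move=> Fn Fm; apply/eqP; rewrite eqn_leq !le_nm.
have minF k v : P v -> \big[minn/k]_(v | P v) F v <= F v.
  move=> Pv; have: v \in index_enum G by rewrite mem_index_enum.
  elim: (index_enum G) => [|w r IHr]; rewrite ?in_nil // big_cons in_cons.
  case/predU1P => [<-|/IHr le_r]; first by rewrite Pv geq_minl.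
  by case: ifP => // _; rewrite geq_min le_r orbT.
move=> Fn Fm; apply: (big_ind (leq (\big[minn/n]_(v | P v) F v))) => //.
- exact: leq_trans (minF n v0 Pv0) (Fm v0).
- by move=> i j le_i le_j; rewrite leq_min le_i.
- exact: minF.
Qed.

Lemma game_value_stable k b (M : {set G}) :
  #|~: dominated M| <= k -> game_value k.+1 b M = game_value k b M.
Proof.
elim: k b M => [|k IHk] b M.
  rewrite leqn0 => /eqP M0 /=; case: existsP => // -[v /legal_card].
  by rewrite M0.
move=> leM; have IH c v : legal M v ->
    game_value k.+1 c (v |: M) = game_value k c (v |: M).
  by move=> Lv; apply: IHk; rewrite -ltnS (leq_trans (legal_card Lv)).
have gvS n c (N : {set G}) : game_value n.+1 c N =
    if [exists v, legal N v] then
      (if c then \big[minn/n]_(v | legal N v) game_value n false (v |: N)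
       else \max_(v | legal N v) game_value n true (v |: N)).+1
    else 0 by [].
rewrite (gvS k.+1) (gvS k); case: existsP => // -[v0 Lv0].
case: b; congr _.+1; rewrite (eq_bigr _ (fun v => IH _ v)) //.
apply: (bigmin_default Lv0) => v; last exact: game_value_le.
exact: leq_trans (game_value_le _ _ _) (leqnSn k).
Qed.

End GameValue.

Definition gg_perfect (G : sgraph) : Prop :=
  forall S : {set G}, S != set0 ->
    game_domination_number (induced S) = domination_number (induced S).

Definition two_gg_perfect (G : sgraph) : Prop :=
  forall S : {set G}, S != set0 ->
    domination_number (induced S) = 2 -> game_domination_number (induced S) = 2.

Definition isomorphic (G H : sgraph) : Prop :=
  exists f : G -> H, bijective f /\ {mono f : x y / x -- y}.

Definition complete_rel s : rel 'I_s := fun i j => i != j.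

Lemma complete_sym s : symmetric (@complete_rel s).
Proof. by move=> i j; rewrite /complete_rel eq_sym. Qed.

Lemma complete_irr s : irreflexive (@complete_rel s).
Proof. by move=> i; rewrite /complete_rel eqxx. Qed.

Definition complete s : sgraph := SGraph (@complete_sym s) (@complete_irr s).

Section Operators.

Definition sum_rel (F H : sgraph) : rel (F + H) := fun x y =>
  match x, y with
  | inl a, inl b => a -- b
  | inr a, inr b => a -- b
  | _, _ => false
  end.

Lemma sum_sym F H : symmetric (@sum_rel F H).
Proof. by move=> [a|a] [b|b] //=; exact: sedge_sym. Qed.

Lemma sum_irr F H : irreflexive (@sum_rel F H).
Proof. by move=> [a|a]; exact: sedge_irr. Qed.

Definition disjoint_union F H : sgraph := SGraph (@sum_sym F H) (@sum_irr F H).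

(* The new vertex v is None. *)
Definition extension_rel (F : sgraph) (C : {set {set F}}) : rel (option F) :=
  fun x y =>
  match x, y with
  | Some a, Some b => a -- b
  | Some a, None | None, Some a => a \notin cover C
  | None, None => false
  end.

Lemma extension_sym F C : symmetric (@extension_rel F C).
Proof. by move=> [a|] [b|] //=; exact: sedge_sym. Qed.

Lemma extension_irr F C : irreflexive (@extension_rel F C).
Proof. by move=> [a|] //=; exact: sedge_irr. Qed.

Definition extension (F : sgraph) (C : {set {set F}}) : sgraph :=
  SGraph (@extension_sym F C) (@extension_irr F C).

End Operators.

Inductive constructible : sgraph -> Prop :=
| constructible_K1 : constructible (complete 1)
| constructible_union (F : sgraph) (s : nat) :
    0 < s -> constructible F -> constructible (disjoint_union F (complete s))
| constructible_extension (F : sgraph) (C : {set {set F}}) :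
    perfect_cliques C -> constructible F -> constructible (extension C).

Definition obtainable (G : sgraph) : Prop :=
  exists2 H : sgraph, constructible H & isomorphic G H.

(* Main.v *)
Require Import Defs.
From mathcomp Require Import all_boot.
From mathcomp Require Import zify.

Set Implicit Arguments.
Unset Strict Implicit.
Unset Printing Implicit Defensive.

(** Call v a pivot if the nonneighbours of v fall into twin classes with
    pairwise disjoint neighbourhoods that are completely joined inside N(v).
    A graph is obtainable iff every nonempty induced subgraph has a pivot: the
    classes without neighbours in N(v) are clique components, the others form
    the perfect set of cliques attached to v.

    After v, every move dominates at least one twin class, so a pivot with m
    classes gives a game of at most m + 1 moves; induction on the graph shows
    that some pivot has fewer classes than any given dominating set has
    vertices, whence equality of the two domination numbers.

    Conversely, in a 2-perfect graph any set S dominated by two of its vertices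
    contains u such that S \ N[u] is a twin class. Let A(u) be the set of
    nonneighbours of u that satisfy the pivot condition, and choose u with
    (|N[u] u A(u)|, |N[u]|) lexicographically maximal. If u is not a pivot, a
    pivot of G - A(u), which exists by minimality of G, leads to a better
    choice or to a pivot of G. *)

(** * Closed adjacency *)

Section ClosedAdjacency.
Variable G : sgraph.
Implicit Types (x y v w : G) (M S : {set G}).

Definition cadj x y := (x == y) || (x -- y).

Lemma cadjC x y : cadj x y = cadj y x.
Proof. by rewrite /cadj eq_sym sedge_sym. Qed.

Lemma cadjxx x : cadj x x.
Proof. by rewrite /cadj eqxx. Qed.

Lemma in_closed_nbh v w : (w \in closed_nbh v) = cadj v w.
Proof. by rewrite !inE eq_sym. Qed.

Lemma sedge_cadj x y : x -- y -> cadj x y.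
Proof. by rewrite /cadj => ->; rewrite orbT. Qed.

Lemma cadj_sedge x y : cadj x y -> x != y -> x -- y.
Proof. by case/orP => // ->. Qed.

Lemma dominatedP M x : reflect (exists2 v, v \in M & cadj v x) (x \in dominated M).
Proof.
by apply: (iffP bigcupP) => -[v vM]; rewrite ?in_closed_nbh => vx; exists v;
  rewrite ?in_closed_nbh.
Qed.

Lemma dominatingP M : reflect (forall x, exists2 v, v \in M & cadj v x) (dominating M).
Proof.
apply: (iffP eqP) => [Mdom x|Mdom]; first by apply/dominatedP; rewrite Mdom inE.
by apply/setP => x; rewrite inE; apply/dominatedP.
Qed.

Lemma legalP M v : reflect (exists2 x, cadj v x & x \notin dominated M) (legal M v).
Proof.
by apply: (iffP subsetPn) => -[x]; rewrite ?in_closed_nbh => vx xM; exists x;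
  rewrite ?in_closed_nbh.
Qed.

Lemma legal_exists M : [exists v, legal M v] = ~~ dominating M.
Proof.
apply/existsP/idP => [[v /legalP[x _ xM]]|].
  by apply: contraNN xM => /eqP ->; rewrite inE.
rewrite /dominating -subTset => /subsetPn[x _ xM].
by exists x; apply/legalP; exists x; rewrite ?cadjxx.
Qed.

End ClosedAdjacency.

(** * Attained minima and the recursion for the game value *)

Lemma bigmin_le (T : finType) (P : pred T) (F : T -> nat) k v :
  P v -> \big[minn/k]_(v | P v) F v <= F v.
Proof.
move=> Pv; have: v \in index_enum T by rewrite mem_index_enum.
elim: (index_enum T) => [|w r IHr]; rewrite ?in_nil // big_cons in_cons.
case/predU1P => [<-|/IHr le_r]; first by rewrite Pv geq_minl.
by case: ifP => // _; rewrite geq_min le_r orbT.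
Qed.

Lemma bigmin_attained (T : finType) (P : pred T) (F : T -> nat) k v0 :
  P v0 -> (forall v, P v -> F v <= k) ->
  exists2 v, P v & \big[minn/k]_(v | P v) F v = F v.
Proof.
move=> Pv0 Fk; case: (arg_minnP F Pv0) => v Pv Fv; exists v => //.
apply/eqP; rewrite eqn_leq bigmin_le //=.
by elim/big_ind: _ => [|i j le_i le_j|]; rewrite ?leq_min ?le_i //; apply: Fk.
Qed.

Section GameRecursion.
Variable G : sgraph.
Implicit Types (v : G) (M : {set G}).

(** The fuel is the number of undominated vertices, which bounds the number of remaining moves
    because each of them dominates a new vertex. *)
Definition value b M := game_value #|~: dominated M| b M.

Lemma game_valueE k b M : #|~: dominated M| <= k -> game_value k b M = value b M.
Proof.
move=> /subnK <-; elim: (k - _) => // n IHn.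
by rewrite addSn game_value_stable ?IHn // leq_addl.
Qed.

Lemma value_dominating b M : dominating M -> value b M = 0.
Proof. by rewrite /value /dominating => /eqP ->; rewrite setCT cards0. Qed.

(** The default [k] of the minimum comes with the bound that lets [bigmin_attained] turn the minimum
    into an actual move. *)
Lemma value_unfold b M : ~~ dominating M ->
  exists2 k, (forall v, legal M v -> value (~~ b) (v |: M) <= k) &
  value b M =
    (if b then \big[minn/k]_(v | legal M v) value false (v |: M)
     else \max_(v | legal M v) value true (v |: M)).+1.
Proof.
move=> Mdom; have := Mdom; rewrite -legal_exists => /existsP[v0 /legal_card].
case Mk: #|~: dominated M| => [//|k] _.
have le_k v : legal M v -> #|~: dominated (v |: M)| <= k.
  by move=> /legal_card; rewrite Mk.
exists k => [v /le_k lek|]; first by rewrite -(game_valueE _ lek) game_value_le.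
rewrite {1}/value Mk /= legal_exists Mdom.
by case: (b); congr _.+1; apply: eq_bigr => v /le_k; apply: game_valueE.
Qed.

Lemma dominator_le M v : legal M v -> value true M <= (value false (v |: M)).+1.
Proof.
move=> Mv; have Mdom: ~~ dominating M by rewrite -legal_exists; apply/existsP; exists v.
by have [k _ ->] := value_unfold true Mdom; rewrite ltnS bigmin_le.
Qed.

Lemma dominator_best M : ~~ dominating M ->
  exists2 v, legal M v & value true M = (value false (v |: M)).+1.
Proof.
move=> Mdom; have [k lek ->] := value_unfold true Mdom.
have := Mdom; rewrite -legal_exists => /existsP[v0 Mv0].
by have [v Mv ->] := bigmin_attained Mv0 lek; exists v.
Qed.

Lemma staller_le M v : legal M v -> value true (v |: M) < value false M.
Proof.
move=> Mv; have Mdom: ~~ dominating M by rewrite -legal_exists; apply/existsP; exists v.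
have [k _ ->] := value_unfold false Mdom.
by rewrite ltnS (bigmax_sup v).
Qed.

Lemma staller_best M : ~~ dominating M ->
  exists2 v, legal M v & value false M = (value true (v |: M)).+1.
Proof.
move=> Mdom; have [k _ ->] := value_unfold false Mdom.
have := Mdom; rewrite -legal_exists => /existsP[v0 Mv0].
have [|v Mv ->] := @eq_bigmax_cond _ (legal M) (fun v => value true (v |: M)).
  by apply/card_gt0P; exists v0.
by exists v.
Qed.

Lemma best_move b M : ~~ dominating M ->
  exists2 v, legal M v & value b M = (value (~~ b) (v |: M)).+1.
Proof. by case: b; [apply: dominator_best | apply: staller_best]. Qed.

Lemma game_domination_numberE : game_domination_number G = value true set0.
Proof. by apply: game_valueE; apply: max_card. Qed.

Lemma domination_number_le M : dominating M -> domination_number G <= #|M|.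
Proof.
move=> Mdom; rewrite /domination_number; case: arg_minnP => [|N _]; last exact.
by apply/dominatingP => x; exists x; rewrite ?inE ?cadjxx.
Qed.

Lemma domination_number_attained :
  exists2 M : {set G}, dominating M & #|M| = domination_number G.
Proof.
rewrite /domination_number; case: arg_minnP => [|N Ndom _]; last by exists N.
by apply/dominatingP => x; exists x; rewrite ?inE ?cadjxx.
Qed.

(** Optimal play from [M] ends in a dominating set, and each move adds at most one vertex to it. *)
Lemma value_dominates b M :
  exists2 N : {set G}, dominating N & #|N| <= #|M| + value b M.
Proof.
have [n] := ubnP #|~: dominated M|; elim: n b M => // n IHn b M; rewrite ltnS => leM.
have [Mdom|/(best_move b)[v Mv ->]] := boolP (dominating M).
  by exists M; rewrite // leq_addr.
have [N Ndom leN] := IHn (~~ b) (v |: M) (leq_trans (legal_card Mv) leM).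
exists N; rewrite // (leq_trans leN) // cardsU1 addnS -addSn leq_add2r.
by case: (v \in M).
Qed.

Lemma domination_number_le_game : domination_number G <= game_domination_number G.
Proof.
rewrite game_domination_numberE; have [N /domination_number_le] := value_dominates true set0.
by rewrite cards0; apply: leq_trans.
Qed.

(* Every move dominates at least one twin class completely. *)
Lemma value_le_classes b M :
  value b M <= #|@closed_nbh G @: ~: dominated M|.
Proof.
have [n] := ubnP #|~: dominated M|; elim: n b M => // n IHn b M; rewrite ltnS => leM.
have [Mdom|/(best_move b)[v Mv ->]] := boolP (dominating M).
  by rewrite value_dominating.
apply: leq_ltn_trans (IHn _ _ (leq_trans (legal_card Mv) leM)) _.
have [x vx xM] := legalP _ _ Mv.
apply/proper_card/properP; split.
  apply/imsetS; rewrite setCS; apply/subsetP => y /dominatedP[w wM wy].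
  by apply/dominatedP; exists w; rewrite // inE wM orbT.
exists (closed_nbh x); first by rewrite imset_f // inE.
apply/imsetP => -[y]; rewrite inE => /negP yM xy; apply: yM.
apply/dominatedP; exists v; first by rewrite !inE eqxx.
by rewrite cadjC -in_closed_nbh -xy in_closed_nbh cadjC.
Qed.

(** Dominator may open with [v]; each later move uses up at least one of the classes left
    undominated. *)
Lemma game_le_classes v :
  game_domination_number G <= #|@closed_nbh G @: ~: closed_nbh v|.+1.
Proof.
have v0 : legal set0 v.
  apply/legalP; exists v; first exact: cadjxx.
  by apply/dominatedP => -[w]; rewrite inE.
rewrite game_domination_numberE (leq_trans (dominator_le v0)) // ltnS.
have -> : closed_nbh v = dominated (v |: set0) by rewrite setU0 /dominated big_set1.
exact: value_le_classes.
Qed.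

End GameRecursion.

(** * Pivots and the game *)

(** Everything is relative to [S], so that induced subgraphs are handled inside [G]. In the twin
    condition one inclusion suffices, as [q] and [r] can be exchanged. In the join condition
    [~~ x -- r] says that [q] and [r] lie in different classes. *)
Definition pivot (G : sgraph) (S : {set G}) (v : G) : Prop :=
  [/\ v \in S,
   forall q r x y, q \in S -> r \in S -> x \in S -> y \in S ->
     ~~ cadj v q -> ~~ cadj v r -> cadj x q -> cadj x r -> cadj y q -> cadj y r &
   forall q r x y, q \in S -> r \in S -> x \in S -> y \in S ->
     ~~ cadj v q -> ~~ cadj v r -> v -- x -> v -- y ->
     x -- q -> y -- r -> ~~ x -- r -> x -- y].

Definition pivotal (G : sgraph) : Prop :=
  forall S : {set G}, S != set0 -> exists v, pivot S v.

Section Embedding.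
Variables (G H : sgraph) (f : G -> H).
Hypothesis f_inj : injective f.
Hypothesis f_mono : {mono f : x y / x -- y}.

Lemma cadj_mono : {mono f : x y / cadj x y}.
Proof. by move=> x y; rewrite /cadj inj_eq // f_mono. Qed.

Lemma pivot_image (S : {set G}) v : pivot (f @: S) (f v) <-> pivot S v.
Proof.
split=> -[vS twin join]; split.
- by rewrite -(mem_imset _ _ f_inj).
- move=> q r x y; rewrite -!(mem_imset S _ f_inj) -!cadj_mono; exact: twin.
- move=> q r x y; rewrite -!(mem_imset S _ f_inj) -!cadj_mono -!f_mono; exact: join.
- by rewrite (mem_imset _ _ f_inj).
- move=> _ _ _ _ /imsetP[q qS ->] /imsetP[r rS ->] /imsetP[x xS ->] /imsetP[y yS ->].
  by rewrite !cadj_mono; exact: twin.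
- move=> _ _ _ _ /imsetP[q qS ->] /imsetP[r rS ->] /imsetP[x xS ->] /imsetP[y yS ->].
  by rewrite !cadj_mono !f_mono; exact: join.
Qed.

Lemma pivotal_embedding : pivotal H -> pivotal G.
Proof.
move=> pivH S; rewrite -(imset_eq0 f S) => /pivH[w piv_w].
have [/imsetP[v _ vw] _ _] := piv_w; exists v; move: piv_w; rewrite vw.
by case/pivot_image.
Qed.

End Embedding.

(** * Twin classes of a pivot against dominating sets *)

Section Classes.
Variable G : sgraph.
Implicit Types (q r v w x : G) (S D : {set G}).

(** A class is represented by the common trace on [S] of the closed neighbourhoods of its
    members. *)
Definition classes S v : {set {set G}} :=
  [set closed_nbh q :&: S | q in S & ~~ cadj v q].

Definition dominates D S := {in S, forall x, exists2 d, d \in D & cadj d x}.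

Lemma class_eqP S q r :
  reflect {in S, forall y, cadj y q = cadj y r}
    (closed_nbh q :&: S == closed_nbh r :&: S).
Proof.
apply: (iffP eqP) => [eq_qr y yS|eq_qr].
  by have /setP/(_ y) := eq_qr; rewrite !in_setI yS !andbT !in_closed_nbh ![cadj _ y]cadjC.
apply/setP => y; rewrite !in_setI !in_closed_nbh ![cadj _ y]cadjC.
by have [/eq_qr->|_] := boolP (y \in S); rewrite ?andbF.
Qed.

Lemma pivot_twins S v q r x : pivot S v -> q \in S -> r \in S -> x \in S ->
  ~~ cadj v q -> ~~ cadj v r -> cadj x q -> cadj x r ->
  {in S, forall y, cadj y q = cadj y r}.
Proof.
move=> [_ twin _] qS rS xS vq vr xq xr y yS.
by apply/idP/idP; [apply: (twin q r x)|apply: (twin r q x)].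
Qed.

Lemma mem_classes S v q : q \in S -> ~~ cadj v q -> closed_nbh q :&: S \in classes S v.
Proof. by move=> qS vq; apply: imset_f; rewrite inE qS. Qed.

(* Distinct classes have disjoint neighbourhoods, so a dominating set contains
   a private element for each of them. *)
Lemma classes_dominating S D v : pivot S v -> D \subset S -> dominates D S ->
  #|classes S v| <= #|D| /\
  (#|D| <= #|classes S v| -> forall d, d \in D -> exists q,
     [/\ q \in S, ~~ cadj v q, cadj d q & forall d', d' \in D -> cadj d' q -> d' = d]).
Proof.
move=> piv /subsetP DS Ddom.
(* [h] chooses an element of [D] that dominates the given class; since [D] dominates [S], the
   default [v] is never reached. *)
pose h (c : {set G}) := odflt v [pick d in D :&: c].
have hP q : q \in S -> ~~ cadj v q ->
    (h (closed_nbh q :&: S) \in D) && cadj (h (closed_nbh q :&: S)) q.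
  move=> qS vq; rewrite /h; case: pickP => [d|no_d] /=.
    by rewrite !in_setI in_closed_nbh cadjC => /and3P[-> ->].
  have [d dD dq] := Ddom q qS.
  by have := no_d d; rewrite !in_setI dD DS // in_closed_nbh cadjC dq.
have h_inj : {in classes S v &, injective h}.
  move=> _ _ /imsetP[q] + -> /imsetP[r] + -> eq_h.
  rewrite !inE => /andP[qS vq] /andP[rS vr]; apply/eqP/class_eqP.
  have /andP[/DS dS dq] := hP q qS vq; have /andP[_ dr] := hP r rS vr.
  by apply: (pivot_twins piv qS rS dS); rewrite // eq_h.
have h_sub : h @: classes S v \subset D.
  apply/subsetP => _ /imsetP[_ /imsetP[q + ->] ->]; rewrite inE => /andP[qS vq].
  by case/andP: (hP q qS vq).
rewrite -(card_in_imset h_inj); split; first exact: subset_leq_card.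
(* With as many classes as elements of [D], every [d] in [D] is the choice for some class, and by
   disjointness no other element of [D] dominates that class. *)
move=> leD; have hD : h @: classes S v = D by apply/eqP; rewrite eqEcard h_sub.
have DP d : d \in D -> exists q,
    [/\ q \in S, ~~ cadj v q, cadj d q & d = h (closed_nbh q :&: S)].
  rewrite -hD => /imsetP[_ /imsetP[q + ->] ->]; rewrite inE => /andP[qS vq].
  by exists q; split=> //; case/andP: (hP q qS vq).
move=> d /DP[q [qS vq dq ->]]; exists q; split=> // [|d' d'D d'q].
  by case/andP: (hP q qS vq).
have [r [rS vr d'r ->]] := DP d' d'D; congr h; apply/eqP/class_eqP.
exact: (pivot_twins piv rS qS (DS d' d'D)).
Qed.

(** A pivot [v] of [S] has at most [#|D|] classes. In case of equality each element of [D] has a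
    private class. Then either the pivot given by induction for [S :\ v] is also a pivot of [S], or
    the element [d0] of [D] dominating [v] is one. *)
Lemma pivot_few_classes S D : pivotal G -> S != set0 -> D \subset S ->
  dominates D S -> exists2 w, pivot S w & #|classes S w| < #|D|.
Proof.
move=> pivG; have [n] := ubnP #|S|; elim: n S => // n IHn S leS S0 DS Ddom.
have [v piv] := pivG S S0; have [vS twin join] := piv.
have [leqD] := classes_dominating piv DS Ddom.
have [leD /(_ isT) DP|ltD _] := leqP; last by exists v.
have cardD : #|classes S v| = #|D| by apply/eqP; rewrite eqn_leq leqD.
move: (DS) => /subsetP DinS.
have [d0 d0D d0v] := Ddom v vS; have d0S := DinS d0 d0D.
have [q0 [q0S vq0 d0q0 d0uniq]] := DP d0 d0D.
have vd0 : v -- d0.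
  by apply: cadj_sedge; [rewrite cadjC|apply: contraNneq vq0 => ->].
have [/existsP[q1 /existsP[x1 /and5P[q1S x1S vq1 d0q1 /andP[vx1 x1q1]]]]|no_q1] :=
  boolP [exists q, exists x, [&& q \in S, x \in S, ~~ cadj v q, ~~ cadj d0 q &
    (v -- x) && (x -- q)]].
- have vD : v \notin D.
    by apply/negP => /DP[q [_ /negP vq /vq]].
  pose S' := S :\ v.
  have S'S x : x \in S' -> x \in S by case/setD1P.
  have inS' x : x \in S -> x != v -> x \in S' by move=> xS xv; apply/setD1P.
  have [||||w piv' lt_w] := IHn S' _ _ _ _.
  + by rewrite (cardsD1 v) vS add1n in leS.
  + apply/set0Pn; exists d0; apply: inS' => //.
    by apply: contraNneq vD => <-.
  + by rewrite subsetD1 DS.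
  + by move=> x /S'S/Ddom.
  have [wS' twin' join'] := piv'.
  have wS := S'S w wS'; have wv : w != v by case/setD1P: wS'.
  have nonv q : ~~ cadj v q -> q != v by apply: contraNneq => ->; apply: cadjxx.
  have classS' q : q \in S -> ~~ cadj v q -> closed_nbh q :&: S' = closed_nbh q :&: S.
    move=> qS vq; apply/setP => x; rewrite !in_setI !in_closed_nbh.
    rewrite in_setD1; case: eqVneq => //= ->.
    by rewrite cadjC (negbTE vq).
  (* If [w] had no neighbour among the nonneighbours of [v], all [#|D|] classes of [v] would be
     classes of [w]. *)
  have [/existsP[q /and3P[qS vq wq]]|no_q] :=
    boolP [exists q, [&& q \in S, ~~ cadj v q & cadj w q]]; last first.
    have : classes S v \subset classes S' w.
      apply/subsetP => _ /imsetP[q + ->]; rewrite inE => /andP[qS vq].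
      rewrite -classS' //; apply: mem_classes; first by rewrite inS' ?nonv.
      by apply: contraNN no_q => wq; apply/existsP; exists q; rewrite qS vq.
    by move/subset_leq_card; rewrite cardD leqNgt lt_w.
  (* [w] is adjacent to no class of [v] other than that of [q], so the others survive as classes of
     [w]; having fewer than [#|D|] classes, [w] has no further ones. *)
  have sub_classes : classes S v :\ (closed_nbh q :&: S) \subset classes S' w.
    apply/subsetP => c /setD1P[+ /imsetP[r + def_c]]; rewrite {c}def_c inE.
    move=> cq /andP[rS vr]; rewrite -classS' //.
    apply: mem_classes; first by rewrite inS' ?nonv.
    apply: contraNN cq => wr; apply/class_eqP.
    exact: (pivot_twins piv rS qS wS).
  have eq_classes : classes S v :\ (closed_nbh q :&: S) = classes S' w.
    apply/eqP; rewrite eqEcard sub_classes /=.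
    have := cardsD1 (closed_nbh q :&: S) (classes S v).
    by rewrite mem_classes // cardD add1n => defD; rewrite -ltnS -defD.
  (* If [v] and [w] are nonadjacent, take neighbours [x], [y] of [v] attached to different classes
     of [a], [b], with [w] missing [a]. Then [w] misses [x] too, so [x] and [a] are twins for [w],
     and [y], joined to [x], reaches both classes. *)
  have [vw|vw] := boolP (cadj v w); last first.
    have [a [b [x [y [[aS bS xS yS] [va vb vx vy] [xa yb xb wa]]]]]] :
        exists a b x y, [/\ [/\ a \in S, b \in S, x \in S & y \in S],
          [/\ ~~ cadj v a, ~~ cadj v b, v -- x & v -- y] &
          [/\ x -- a, y -- b, ~~ x -- b & ~~ cadj w a]].
      have d0q0' : d0 -- q0.
        by apply: cadj_sedge => //; apply: contraNneq vq0 => <-; apply: sedge_cadj.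
      have [wq0|wq0] := boolP (cadj w q0); last first.
        exists q0, q1, d0, x1; split=> //; split=> //.
        by apply: contraNN d0q1; apply: sedge_cadj.
      exists q1, q0, x1, d0; split=> //; split=> //.
        apply: contraNN d0q1 => x1q0.
        by apply: (twin q0 q1 x1 d0); rewrite // ?sedge_cadj.
      by apply: contraNN d0q1 => wq1; apply: (twin q0 q1 w d0).
    have wx : ~~ cadj w x.
      apply: contraNN wa => wx.
      by apply: (twin w a x w) => //; [rewrite cadjC|apply: sedge_cadj|apply: cadjxx].
    have xv : x != v by apply: contraTneq vx => ->; rewrite sedge_irr.
    have yv : y != v by apply: contraTneq vy => ->; rewrite sedge_irr.
    have yx : cadj y x by rewrite cadjC sedge_cadj // (join a b x y).
    have ya : cadj y a.
      by apply: (twin' x a x y); rewrite ?inS' ?cadjxx // ?nonv // sedge_cadj.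
    have : cadj x b by apply: (twin a b y x); rewrite // ?sedge_cadj.
    by case/orP=> [/eqP xb'|]; [rewrite -xb' sedge_cadj in vb|rewrite (negbTE xb)].
  have vw' : v -- w by apply: cadj_sedge => //; rewrite eq_sym.
  have wq' : w -- q by apply: cadj_sedge => //; apply: contraNneq vq => <-.
  (* If [v] were adjacent to [p], then [p] would share its class with a nonneighbour [r] of [v], and
     the join condition at [v] for [w -- q] and [p -- r] would give [w -- p]. *)
  have far p : p \in S -> ~~ cadj w p -> ~~ cadj v p.
    move=> pS wp; have pv : p != v.
      by apply: contraNneq wp => ->; rewrite cadjC.
    have pS' := inS' p pS pv.
    have : closed_nbh p :&: S' \in classes S' w by apply: mem_classes.
    rewrite -eq_classes => /setD1P[_ /imsetP[r + eq_pr]].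
    rewrite inE => /andP[rS vr]; rewrite -classS' // in eq_pr.
    have {}eq_pr := elimT (class_eqP _ _ _) (introT eqP eq_pr).
    apply/negP => vp; have vp' : v -- p by apply: cadj_sedge; rewrite // eq_sym.
    have pr : p -- r.
      by apply: cadj_sedge; [rewrite -eq_pr ?cadjxx|apply: contraNneq vr => <-].
    case/negP: (wp); apply/sedge_cadj/(join q r) => //.
    by apply/negP => /sedge_cadj; rewrite -eq_pr //; apply/negP.
  exists w.
    split=> // [p r x y pS rS xS yS /(far p pS) vp /(far r rS) vr|]; first exact: twin.
    move=> p r x y pS rS xS yS wp wr wx wy xp yr.
    have vp := far p pS wp; have vr := far r rS wr.
    have neqv z z' : z -- z' -> ~~ cadj v z' -> z != v.
      by move=> + vz'; apply: contraTneq => ->; apply: contraNN vz'; apply: sedge_cadj.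
    apply: (join' p r) => //; apply: inS' => //; try exact: nonv.
      exact: neqv xp vp.
    exact: neqv yr vr.
  apply: leq_ltn_trans lt_w; rewrite -eq_classes; apply/subset_leq_card/subsetP.
  move=> _ /imsetP[p + ->]; rewrite inE => /andP[pS wp].
  rewrite in_setD1 mem_classes ?far // andbT.
  by apply: contraNN wp => /class_eqP->.
(* Now the classes of [v] missed by [d0] have no neighbour in the neighbourhood of [v], so they are
   clique components of [S]. All nonneighbours of [d0] lie in them, so [d0] is a pivot with vacuous
   join condition, and the class of [q0] is not among its classes. *)
- have clique d q x : d \in S -> q \in S -> x \in S -> ~~ cadj v q -> ~~ cadj d0 q ->
      cadj d q -> cadj x d -> [/\ ~~ cadj v d, ~~ cadj v x & cadj x q].
    move=> dS qS xS vq d0q dq xd.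
    have nearq z : z \in S -> cadj z q -> ~~ cadj v z.
      move=> zS zq; have zv : z != v by apply: contraNneq vq => <-.
      apply: contraNN no_q1 => vz; apply/existsP; exists q; apply/existsP; exists z.
      rewrite qS zS vq d0q cadj_sedge ?[v == z]eq_sym //= cadj_sedge //.
      by apply: contraNneq vq => <-.
    have vd := nearq d dS dq.
    have xq : cadj x q by apply: (twin d q d x); rewrite // ?cadjxx.
    by split=> //; apply: nearq.
  have far p : p \in S -> ~~ cadj d0 p -> exists2 q,
      [/\ q \in S, ~~ cadj v q & ~~ cadj d0 q] & {in S, forall x, cadj x p -> cadj x q}.
    move=> pS d0p; have [d dD dp] := Ddom p pS; have dS := DinS d dD.
    have [q [qS vq dq duniq]] := DP d dD.
    have d0q : ~~ cadj d0 q.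
      by apply/negP => /(duniq d0 d0D) eq_d; rewrite eq_d dp in d0p.
    exists q => // x xS xp.
    have [_ vp pq] := clique d q p dS qS pS vq d0q dq (etrans (cadjC _ _) dp).
    by apply: (twin p q p x); rewrite // ?cadjxx.
  have far' p : p \in S -> ~~ cadj d0 p -> ~~ cadj v p.
    move=> pS d0p; have [q [qS vq d0q] /(_ p pS (cadjxx p)) pq] := far p pS d0p.
    by have [] := clique p q p pS qS pS vq d0q pq (cadjxx p).
  exists d0.
    split=> // [p r x y pS rS xS yS /(far' p pS) vp /(far' r rS) vr|]; first exact: twin.
    move=> p r x y pS rS xS yS d0p _ d0x _ xp.
    have [q [qS vq d0q] sub_q] := far p pS d0p.
    have xq := sub_q x xS (sedge_cadj xp).
    have pq := sub_q p pS (cadjxx p).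
    case/negP: (d0q); have [_ vx _] := clique p q x pS qS xS vq d0q pq (sedge_cadj xp).
    by apply: (twin x q x d0); rewrite ?cadjxx // ?sedge_cadj.
  rewrite -cardD (cardsD1 (closed_nbh q0 :&: S) (classes S v)) mem_classes // ltnS.
  apply/subset_leq_card/subsetP => _ /imsetP[p + ->]; rewrite inE => /andP[pS d0p].
  rewrite in_setD1 mem_classes ?far' // andbT.
  by apply: contraNN d0p => /class_eqP->.
Qed.

Lemma pivotal_game : 0 < #|G| -> pivotal G ->
  game_domination_number G = domination_number G.
Proof.
move=> G0 pivG; apply/eqP; rewrite eqn_leq domination_number_le_game andbT.
have [D /dominatingP Ddom <-] := domination_number_attained G.
have [| | |w _] := @pivot_few_classes setT D pivG.
- by rewrite -cards_eq0 cardsT -lt0n.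
- exact: subsetT.
- by move=> x _; apply: Ddom.
apply: leq_trans; apply: leq_trans (game_le_classes w) _; rewrite ltnS.
apply/subset_leq_card/subsetP => _ /imsetP[q + ->].
rewrite in_setC in_closed_nbh => wq; rewrite -(setIT (closed_nbh q)).
by apply: mem_classes; rewrite ?inE.
Qed.

End Classes.

(** * Pivots in 2-perfect graphs *)

(** A game-free form of 2-perfection: [u] is a first move of Dominator after which every legal reply
    inside [S] dominates all that is left. *)
Definition pair_centered (G : sgraph) : Prop :=
  forall (S : {set G}) a b, a \in S -> b \in S ->
    {in S, forall x, cadj a x || cadj b x} ->
    exists2 u, u \in S & forall q r x, q \in S -> r \in S -> x \in S ->
      ~~ cadj u q -> ~~ cadj u r -> cadj x q -> cadj x r.

Lemma game_two_center (G : sgraph) (a b : G) :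
  (domination_number G = 2 -> game_domination_number G = 2) ->
  (forall x, cadj a x || cadj b x) ->
  exists u : G, forall q r x,
    ~~ cadj u q -> ~~ cadj u r -> cadj x q -> cadj x r.
Proof.
move=> game2 abdom.
have [/existsP[u /forallP udom]|no_univ] := boolP [exists u : G, forall x, cadj u x].
  by exists u => q r x; rewrite udom.
have dom2 : domination_number G = 2.
  apply/eqP; rewrite eqn_leq; apply/andP; split.
    apply: leq_trans (domination_number_le _) (_ : #|[set a; b]| <= 2).
      by apply/dominatingP => x; have /orP[ax|bx] := abdom x;
        [exists a|exists b]; rewrite // !inE eqxx ?orbT.
    by rewrite cards2; case: (a != b).
  have [M /dominatingP Mdom <-] := domination_number_attained G.
  have [d dM _] := Mdom a; rewrite ltnNge; apply: contraNN no_univ => /card_le1_eqP M1.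
  by apply/existsP; exists d; apply/forallP => x; have [e /(M1 d)->] := Mdom x.
have := game2 dom2; rewrite game_domination_numberE => val2.
have [dom0|/dominator_best[v _]] := boolP (dominating (set0 : {set G})).
  by rewrite value_dominating in val2.
rewrite val2 setU0 => -[val1]; exists v.
(* A vertex reaching an undominated [q] is a legal reply; the game ends with it, so it reaches every
   undominated [r]. *)
have reply w q : ~~ cadj v q -> cadj w q -> forall r, ~~ cadj v r -> cadj w r.
  move=> vq wq r vr; have legal_w : legal [set v] w.
    apply/legalP; exists q => //.
    by apply/dominatedP => -[v' /set1P->]; apply/negP.
  have := staller_le legal_w; rewrite -val1 ltnS leqn0 => val0.
  have [/dominatingP/(_ r)[v']|/(best_move true)[v' _ valS]] := boolP (dominating (w |: [set v])).
    by rewrite !inE => /orP[/eqP->|/eqP->] //; rewrite (negbTE vr).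
  by rewrite valS in val0.
move=> q r x vq vr xq; exact: reply xq r vr.
Qed.

Section Induced.
Variables (G : sgraph) (S : {set G}).

Lemma induced_val_inj : injective (val : induced S -> G).
Proof. exact: val_inj. Qed.

Lemma induced_val_mono : {mono (val : induced S -> G) : x y / x -- y}.
Proof. by []. Qed.

Lemma cadj_induced (x y : induced S) : cadj (val x) (val y) = cadj x y.
Proof. exact: (cadj_mono induced_val_inj induced_val_mono). Qed.

End Induced.

Lemma two_gg_perfect_pair_centered (G : sgraph) :
  two_gg_perfect G -> pair_centered G.
Proof.
move=> perfG S a b aS bS abdom; pose F := induced S.
have S0 : S != set0 by apply/set0Pn; exists a.
have [|u Pu] := @game_two_center F (Sub a aS) (Sub b bS) (perfG S S0).
  by move=> x; rewrite -!cadj_induced abdom //; apply: valP.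
exists (val u) => [|q r x qS rS xS]; first exact: valP.
by have := Pu (Sub q qS) (Sub r rS) (Sub x xS); rewrite -!cadj_induced.
Qed.

Lemma pair_centered_induced (G : sgraph) (S : {set G}) :
  pair_centered G -> pair_centered (induced S).
Proof.
move=> pairG S' a b aS' bS' abdom.
have [||_ /imsetP[x xS' ->]|_ /imsetP[u uS' ->] Pu] := pairG (val @: S') (val a) (val b).
- exact: imset_f.
- exact: imset_f.
- by rewrite !cadj_induced abdom.
exists u => // q r x qS' rS' xS'; rewrite -!cadj_induced.
by apply: Pu; apply: imset_f.
Qed.

(** * Existence of a pivot by an extremal choice *)

Section PivotExistence.
Variable G : sgraph.
Hypothesis pairG : pair_centered G.
Implicit Types (u v w q r x y z : G).

(** The path is dominated by [b] and [d], but each of its five vertices has two nonneighbours on it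
    that are not twins in the path. *)
Lemma no_induced_P5 (a b c d e : G) :
  cadj a b -> cadj b c -> cadj c d -> cadj d e ->
  ~~ cadj a c -> ~~ cadj a d -> ~~ cadj a e -> ~~ cadj b d -> ~~ cadj b e ->
  ~~ cadj c e -> False.
Proof.
move=> ab bc cd de ac ad ae bd be ce.
have [|||u] := pairG (S := [set x in [:: a; b; c; d; e]]) (a := b) (b := d).
- by rewrite !inE eqxx ?orbT.
- by rewrite !inE eqxx ?orbT.
- move=> x; rewrite !inE => /or4P[|||/orP[]] /eqP->;
    by rewrite ?cadjxx ?bc ?de ?(cadjC b a) ?ab ?orbT.
have far q r x : q \in [:: a; b; c; d; e] -> r \in [:: a; b; c; d; e] ->
    x \in [:: a; b; c; d; e] -> ~~ cadj u q -> ~~ cadj u r -> cadj x q -> ~~ cadj x r ->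
    ~ (forall q r x, q \in [set x in [:: a; b; c; d; e]] ->
      r \in [set x in [:: a; b; c; d; e]] -> x \in [set x in [:: a; b; c; d; e]] ->
      ~~ cadj u q -> ~~ cadj u r -> cadj x q -> cadj x r).
  move=> qS rS xS uq ur xq /negP xr Pu; apply: xr.
  by apply: Pu xq; rewrite // in_set.
rewrite in_set !inE => /or4P[|||/orP[]] /eqP eq_u; rewrite {u}eq_u in far *.
- by apply: (far c e c); rewrite ?inE ?eqxx ?orbT ?cadjxx.
- by apply: (far d e c); rewrite ?inE ?eqxx ?orbT.
- by apply: (far a e a); rewrite ?inE ?eqxx ?orbT ?cadjxx // cadjC.
- by apply: (far b a c); rewrite ?inE ?eqxx ?orbT // cadjC.
by apply: (far c a c); rewrite ?inE ?eqxx ?orbT ?cadjxx // cadjC.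
Qed.

(** Otherwise [q], [x], [u], [y], [r] induce a path. Hence the join condition of a pivot follows
    here from the twin condition. *)
Lemma join_nbh u q r x y : ~~ cadj u q -> ~~ cadj u r -> cadj u x -> cadj u y ->
  cadj x q -> cadj y r -> (forall z, cadj z q -> ~~ cadj z r) -> cadj x y.
Proof.
move=> uq ur ux uy xq yr qr; apply/negPn/negP => xy.
apply: (@no_induced_P5 q x u y r); rewrite ?(cadjC q) ?(cadjC x u) //.
- by apply: contraTN yr; apply: qr.
- by rewrite cadjC; apply: qr; apply: cadjxx.
- exact: qr.
Qed.

(* The nonneighbours of [u] that do not obstruct [u] from being a pivot. *)
Definition settled u := [set q | ~~ cadj u q &
  [forall r, (~~ cadj u r && [exists x, cadj x q && cadj x r]) ==>
             (closed_nbh q == closed_nbh r)]].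

Lemma settledP u q : reflect
  (~~ cadj u q /\ forall r x, ~~ cadj u r -> cadj x q -> cadj x r ->
                  forall y, cadj y q = cadj y r) (q \in settled u).
Proof.
rewrite inE; apply: (iffP andP) => -[uq Pq]; split=> //.
  move=> r x ur xq xr y; move/forallP/(_ r): Pq; rewrite ur /=.
  have -> : [exists x, cadj x q && cadj x r] by apply/existsP; exists x; rewrite xq.
  by move/eqP/setP/(_ y); rewrite !in_closed_nbh ![cadj _ y]cadjC.
apply/forallP => r; apply/implyP => /andP[ur /existsP[x /andP[xq xr]]].
by apply/eqP/setP => y; rewrite !in_closed_nbh ![cadj _ y]cadjC; apply: Pq xr _.
Qed.

Definition reach u := closed_nbh u :|: settled u.

Lemma in_reach u q : (q \in reach u) = cadj u q || (q \in settled u).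
Proof. by rewrite in_setU in_closed_nbh. Qed.

Lemma reach_pivot u : reach u = setT -> pivot setT u.
Proof.
move=> reachT; have set_far q : ~~ cadj u q -> q \in settled u.
  by move=> /negbTE uq; have := in_setT q; rewrite -reachT in_reach uq.
split=> // [q r x y _ _ _ _ uq ur xq xr|q r x y _ _ _ _ uq ur ux uy xq yr xr].
  by have /settledP[_ /(_ r x ur xq xr) <-] := set_far q uq.
apply: cadj_sedge; last by apply: contraNneq xr => ->.
have x_r : ~~ cadj x r.
  by apply: contraNN xr => /cadj_sedge; apply; apply: contraNneq ur => <-; apply: sedge_cadj.
apply: (join_nbh uq ur) => //; try exact: sedge_cadj.
move=> z zq; apply/negP => zr; case/negP: x_r.
by have /settledP[_ /(_ r z ur zq zr) <-] := set_far q uq; apply: sedge_cadj.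
Qed.

Lemma settled_closed u q r x : q \in settled u -> ~~ cadj u r -> cadj x q -> cadj x r ->
  r \in settled u.
Proof.
move=> /settledP[uq Pq] ur xq xr; apply/settledP; split=> // s y us yr ys z.
by rewrite -(Pq r x) // (Pq s y) // (Pq r x).
Qed.

(** Passing from [u] to [v] leaves fewer nonneighbours, hence fewer obstructions to being
    settled. *)
Lemma reach_mono u v : closed_nbh u \subset closed_nbh v -> reach u \subset reach v.
Proof.
move=> /subsetP sub_uv; have uv z : cadj u z -> cadj v z.
  by rewrite -!in_closed_nbh; apply: sub_uv.
apply/subsetP => q; rewrite !in_reach; have [//|vq] := boolP (cadj v q).
have uq := contraNN (@uv q) vq; rewrite (negbTE uq) /= => /settledP[_ Pq].
by apply/settledP; split=> // r x vr; apply: Pq; apply: contraNN vr; apply: uv.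
Qed.

(** The lexicographic order on the two cardinalities, encoded in base [#|G|.+1], which exceeds the
    second one. *)
Definition measure u := #|reach u| * #|G|.+1 + #|closed_nbh u|.

Lemma measure_lt_reach u v : #|reach u| < #|reach v| -> measure u < measure v.
Proof.
rewrite /measure => lt_uv.
have leu : #|closed_nbh u| <= #|G| := max_card _.
by have := leq_mul lt_uv (leqnn #|G|.+1); lia.
Qed.

Lemma measure_lt_nbh u v : closed_nbh u \proper closed_nbh v -> measure u < measure v.
Proof.
move=> lt_uv; rewrite /measure -addnS leq_add ?proper_card //.
by rewrite leq_mul // subset_leq_card // reach_mono // proper_sub.
Qed.

(** If nothing is settled, then [reach u] is just [closed_nbh u]. Among all unions of two closed
    neighbourhoods take a largest one, [F c d], with center [v]. By maximality it lies in [reach v],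
    and it is larger than [closed_nbh u] since [u] has a nonneighbour [b]. *)
Lemma settled_nonempty u : (forall v, measure v <= measure u) -> reach u != setT ->
  settled u != set0.
Proof.
move=> u_max; apply: contraNneq => set0u.
have reachu : reach u = closed_nbh u by rewrite /reach set0u setU0.
rewrite reachu -subTset; apply/subsetP => b _; rewrite in_closed_nbh.
apply/negPn/negP => ub.
pose F (a b : G) := closed_nbh a :|: closed_nbh b.
have inF c d z : (z \in F c d) = cadj c z || cadj d z.
  by rewrite in_setU !in_closed_nbh.
case: (@arg_maxnP _ (u, b) predT (fun p : G * G => #|F p.1 p.2|) isT) => -[c d] _ /= F_max.
have max_ub : #|F u b| <= #|F c d| by apply: (F_max (u, b)).
have {}F_max c' d' : F c d \subset F c' d' -> F c d = F c' d'.
  by move=> sub; apply/eqP; rewrite eqEcard sub; apply: (F_max (c', d')).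
have [|||v vF Pv] := pairG (S := F c d) (a := c) (b := d).
- by rewrite inF cadjxx.
- by rewrite inF cadjxx orbT.
- by move=> x; rewrite inF.
suff leF : F c d \subset reach v.
  have := u_max v; rewrite leqNgt => /negP; apply; apply: measure_lt_reach.
  apply: leq_trans (subset_leq_card leF); apply: leq_trans max_ub.
  rewrite reachu; apply/proper_card/properP; split; first exact: subsetUl.
  by exists b; rewrite ?inF ?cadjxx ?orbT // in_closed_nbh.
apply/subsetP => q qF; rewrite in_reach; have [//|vq /=] := boolP (cadj v q).
have covered x z : x \in F c d -> cadj x q -> z \in F c d -> cadj v z || cadj x z.
  move=> xF xq zF; have [//|vz /=] := boolP (cadj v z).
  exact: (Pv q z x).
(* [v] and [z] also dominate [F c d], so by maximality [F c d] equals [F v z] and contains the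
   closed neighbourhood of [z]. *)
have closedF z y : z \in F c d -> ~~ cadj v z -> cadj z y -> y \in F c d.
  move=> zF vz zy; rewrite (F_max v z) ?inF ?zy ?orbT //.
  apply/subsetP => t tF; rewrite inF; have [//|vt /=] := boolP (cadj v t).
  by apply: (Pv z t z); rewrite // cadjxx.
apply/settledP; split=> // r x vr xq xr.
have xF : x \in F c d by apply: (closedF q); rewrite // cadjC.
have rF : r \in F c d.
  have [vx|vx] := boolP (cadj v x); last exact: (closedF x).
  rewrite (F_max v x) ?inF ?xr ?orbT //.
  by apply/subsetP => t tF; rewrite inF covered.
move=> y; apply/idP/idP => [yq|yr].
  by apply: (Pv q r y) => //; apply: (closedF q); rewrite // cadjC.
by apply: (Pv r q y) => //; apply: (closedF r); rewrite // cadjC.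
Qed.

Lemma pivot_step : (forall S : {set G}, S != set0 -> S != setT -> exists v, pivot S v) ->
  0 < #|G| -> exists v, pivot [set: G] v.
Proof.
move=> subG G0.
have [/existsP[v /eqP /reach_pivot]|/existsPn no_reach] := boolP [exists v, reach v == setT].
  by exists v.
have [u0 _] : exists u0 : G, true by case/card_gt0P: G0 => u0; exists u0.
case: (@arg_maxnP _ u0 predT measure isT) => u _ u_max.
have {}u_max v : measure v <= measure u by apply: u_max.
have no_larger v : ~~ (closed_nbh u \proper closed_nbh v).
  by apply/negP => /measure_lt_nbh; rewrite ltnNge u_max.
have [a0 a0A] := set0Pn _ (settled_nonempty u_max (no_reach u)).
set A := settled u in a0A.
have uA : u \notin A by rewrite /A inE cadjxx.
have A_far a : a \in A -> ~~ cadj u a by case/settledP.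
(* [W] holds the nonneighbours that obstruct [u]; no closed neighbourhood meets both [A] and [W]. *)
pose W := ~: reach u.
have inW w : (w \in W) = ~~ cadj u w && (w \notin A) by rewrite in_setC in_reach negb_or.
have AW a w x : a \in A -> w \in W -> cadj x a -> ~~ cadj x w.
  move=> aA; rewrite inW => /andP[uw wA] xa; apply: contraNN wA => xw.
  exact: (settled_closed aA uw xa xw).
have A_nbh a z : a \in A -> cadj z a -> ~~ cadj u z -> z \in A.
  by move=> aA za uz; apply: (settled_closed aA uz za); apply: cadjxx.
have A_twin a a' x : a \in A -> a' \in A -> cadj x a -> cadj x a' ->
    forall y, cadj y a = cadj y a'.
  by move=> /settledP[_ Pa] /A_far ua'; apply: Pa.
have A_out a z : a \in A -> cadj z a -> z \notin A -> cadj u z.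
  by move=> aA za; apply: contraNT => uz; apply: (A_nbh a).
have not_pivot v : (forall q r x y, ~~ cadj v q -> ~~ cadj v r ->
    cadj x q -> cadj x r -> cadj y q -> cadj y r) -> False.
  move=> Pv; have /negP := no_reach v; apply; rewrite -subTset.
  apply/subsetP => q _; rewrite in_reach; have [//|vq /=] := boolP (cadj v q).
  apply/settledP; split=> // r x vr xq xr y.
  by apply/idP/idP; [apply: (Pv q r x)|apply: (Pv r q x)].
have A_edge a : a \in A -> exists2 x, cadj u x & cadj x a.
  move=> aA; have [/existsP[x /andP[ux xa]]|] := boolP [exists x, cadj u x && cadj x a].
    by exists x.
  (* Otherwise [Q] is a clique component, and a pivot of its complement satisfies the twin condition
     in all of [G]. *)
  move=> /existsPn Qu; exfalso; pose Q := closed_nbh a.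
  have inQ z : (z \in Q) = cadj z a by rewrite in_closed_nbh cadjC.
  have Q_twin z : z \in Q -> forall y, cadj y z = cadj y a.
    rewrite inQ => za; have uz : ~~ cadj u z by have := Qu z; rewrite za andbT.
    by apply: (@A_twin z a z); rewrite ?cadjxx // (A_nbh a).
  have QC z y : z \in ~: Q -> cadj y z -> y \in ~: Q.
    rewrite !in_setC => zQ yz; apply: contraNN zQ => yQ.
    by rewrite inQ -(Q_twin y yQ) cadjC.
  have [||v [vQ twin _]] := subG (~: Q).
  - by apply/set0Pn; exists u; rewrite in_setC inQ A_far.
  - by apply/eqP => /setP/(_ a); rewrite in_setC inQ cadjxx in_setT.
  apply: (not_pivot v) => q r x y vq vr xq xr yq.
  have [qQ|qQ] := boolP (q \in Q).
    have xQ : x \in Q by rewrite inQ -(Q_twin q).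
    have rQ : r \in Q by rewrite inQ -(Q_twin x) // cadjC.
    by rewrite (Q_twin r) // -(Q_twin q).
  rewrite -in_setC in qQ.
  have xQ := QC q x qQ xq; have rQ := QC x r xQ (etrans (cadjC _ _) xr).
  by apply: (twin q r x y) => //; apply: (QC q).
have AW_join a w x y : a \in A -> w \in W -> cadj u x -> cadj u y ->
    cadj x a -> cadj y w -> cadj x y.
  move=> aA wW ux uy xa yw; have := wW; rewrite inW => /andP[uw _].
  by apply: (join_nbh (A_far a aA) uw) => // z; apply: AW.
have [||u' [u'A twin _]] := subG (~: A).
- by apply/set0Pn; exists u; rewrite in_setC.
- by apply/eqP => /setP/(_ a0); rewrite in_setC a0A in_setT.
have {}twin q r x y : q \notin A -> r \notin A -> x \notin A -> y \notin A ->
    ~~ cadj u' q -> ~~ cadj u' r -> cadj x q -> cadj x r -> cadj y q -> cadj y r.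
  by rewrite -!(in_setC _ A); apply: twin.
rewrite in_setC in u'A.
have W_twin q r x y : q \in W -> r \in W ->
    ~~ cadj u' q -> ~~ cadj u' r -> cadj x q -> cadj x r -> cadj y q -> cadj y r.
  move=> qW rW u'q u'r xq xr yq.
  have offA z : cadj z q -> z \notin A.
    by apply: contraTN => zA; apply: (AW z); rewrite ?cadjxx.
  have := (qW, rW); rewrite !inW => -[/andP[_ qA] /andP[_ rA]].
  by apply: (twin q r x y) => //; apply: offA.
(* It is enough to compare nonneighbours outside [A]: those in [A] are settled. *)
have AW_twin v : (forall q, ~~ cadj v q -> q \in A \/ q \in W /\ ~~ cadj u' q) -> False.
  move=> vAW; apply: (not_pivot v) => q r x y vq vr xq xr yq.
  have far z : ~~ cadj v z -> ~~ cadj u z.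
    by case/vAW=> [/A_far|[]] //; rewrite inW => /andP[].
  have [/settledP[_ Pq]|[qW u'q]] := vAW q vq; first by rewrite -(Pq r x) ?far.
  have [/settledP[_ Pr]|[rW u'r]] := vAW r vr; first by rewrite (Pr q x) ?far.
  exact: (W_twin q r x).
have [w0 w0W u'w0] : exists2 w0, w0 \in W & cadj u' w0.
  have [/existsP[w0 /andP[]]|/existsPn no_w0] := boolP [exists w0, (w0 \in W) && cadj u' w0].
    by exists w0.
  case: (AW_twin u) => q uq; have [qA|qA] := boolP (q \in A); [by left|right].
  have qW : q \in W by rewrite inW uq.
  by split=> //; have := no_w0 q; rewrite qW.
(* If [u] and [u'] are nonadjacent, a neighbour [x] of [u] attached to [a0] is missed by [u'], so
   [u] and [x] are twins for [u'] outside [A]. Then the closed neighbourhood of [x] properly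
   contains that of [u]. *)
have [uu'|uu'] := boolP (cadj u u'); last first.
  have u'W : u' \in W by rewrite inW uu'.
  have [x ux xa0] := A_edge a0 a0A.
  have u'x : ~~ cadj u' x by rewrite cadjC (AW a0).
  have Nu z : cadj u z -> z \notin A by apply: contraTN => /A_far.
  case/negP: (no_larger x); apply/properP; split; last first.
    by exists a0; rewrite in_closed_nbh // A_far.
  apply/subsetP => z; rewrite !in_closed_nbh => uz; rewrite cadjC.
  by apply: (twin u x u z); rewrite ?cadjxx ?Nu ?cadjxx // cadjC.
have u'_near a z : a \in A -> cadj z a -> cadj u z -> cadj u' z.
  by move=> aA za uz; rewrite cadjC; apply: (AW_join a w0).
(* Without such a [t], no vertex reaches both a nonneighbour of [u'] in [A] and one outside, so [u']
   itself satisfies the twin condition. *)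
have [/existsP[t /existsP[a /existsP[x /and5P[tA u't aA ux /andP[xa xt]]]]]|no_t] :=
  boolP [exists t, exists a, exists x, [&& t \notin A, ~~ cadj u' t, a \in A,
    cadj u x & cadj x a && cadj x t]]; last first.
  have mixed q r x : q \in A -> r \notin A -> ~~ cadj u' r ->
      cadj x q -> ~~ cadj x r.
    move=> qA rA u'r xq; apply/negP => xr; have [xA|xA] := boolP (x \in A).
      have rx : cadj r x by rewrite cadjC.
      by case/negP: u'r; apply: (u'_near x) => //; apply: (A_out x).
    case/negP: no_t; apply/existsP; exists r; apply/existsP; exists q; apply/existsP; exists x.
    by rewrite rA u'r qA xq xr (A_out q).
  case: (not_pivot u') => q r x y u'q u'r xq xr yq.
  have [qA|qA] := boolP (q \in A).
    have rA : r \in A by apply: contraTT xr => rA; apply: (mixed q).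
    by rewrite -(A_twin q r x).
  have rA : r \notin A.
    by apply: contraTN xq => rA; apply: (mixed r).
  have offA z : cadj z q -> z \notin A.
    by apply: contraTN => zA; apply: (mixed z); rewrite ?cadjxx.
  by apply: (twin q r x y) => //; apply: offA.
have ut : cadj u t.
  by apply: contraTT xt => ut; apply: (AW a); rewrite // inW ut.
have Nu z : cadj u z -> z \notin A by apply: contraTN => /A_far.
(* [S] contains [closed_nbh u], [a] and [w0]. Since [a] and [w0] are nonadjacent, a center [y] of
   [S] is adjacent to one of them. *)
pose S := closed_nbh u' :|: closed_nbh x.
have inS z : (z \in S) = cadj u' z || cadj x z by rewrite in_setU !in_closed_nbh.
have NuS z : cadj u z -> z \in S.
  move=> uz; rewrite inS; have [//|u'z /=] := boolP (cadj u' z).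
  by apply: (twin t z u x); rewrite ?Nu ?cadjxx.
have uS : u \in S by rewrite inS cadjC uu'.
have aS : a \in S by rewrite inS xa orbT.
have w0S : w0 \in S by rewrite inS u'w0.
have [|||y yS Py] := pairG (S := S) (a := u') (b := x).
- by rewrite inS cadjxx.
- by rewrite inS cadjxx orbT.
- by move=> z; rewrite inS.
have uw0 : ~~ cadj u w0 by move: w0W; rewrite inW => /andP[].
have aw0 : ~~ cadj a w0 by apply: (AW a); rewrite ?cadjxx.
(* If [y] reaches [w0], then its nonneighbours fit [AW_twin]; otherwise it reaches [a] and its
   closed neighbourhood properly contains that of [u]. *)
have [yw0|yw0] := boolP (cadj y w0).
  have ya : ~~ cadj y a by apply: contraTN yw0; apply: AW.
  have uy : cadj u y.
    rewrite cadjC; apply: contraNT (A_far a aA) => yu.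
    by rewrite cadjC; apply: (Py a u a); rewrite ?cadjxx.
  case: (AW_twin y) => q yq; have [qS|] := boolP (q \in S).
    left; have aq : cadj a q by apply: (Py a q a); rewrite ?cadjxx.
    apply: contraNT yq => qA; rewrite cadjC in aq; rewrite cadjC.
    by apply: (AW_join a w0); rewrite // (A_out a).
  move=> qS; have [qA|qA] := boolP (q \in A); [by left|right].
  rewrite inW qA (contraNN (NuS q)) //; split=> //.
  by move: qS; rewrite inS negb_or => /andP[].
have ya : cadj y a.
  by apply: contraNT aw0 => ya; apply: (Py a w0 a); rewrite ?cadjxx.
case/negP: (no_larger y); apply/properP; split; last first.
  by exists a; rewrite in_closed_nbh // A_far.
apply/subsetP => z; rewrite !in_closed_nbh => uz.
apply: contraNT uw0 => yz.
by apply: (Py z w0 u) => //; apply: NuS.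
Qed.

End PivotExistence.

Lemma pair_centered_pivotal (G : sgraph) : pair_centered G -> pivotal G.
Proof.
move=> pairG S; have [n] := ubnP #|S|; elim: n S => // n IHn S; rewrite ltnS => leS S0.
pose F := induced S; have F_inj := @induced_val_inj G S.
have cardF : #|F| = #|S| by rewrite card_sig; apply: eq_card => x; rewrite inE.
have [||v] := @pivot_step F (pair_centered_induced pairG).
- move=> S' S'0 S'T; have [||w piv_w] := IHn [set val x | x : F in S'].
  + rewrite card_imset //; apply: leq_trans leS; rewrite -cardF -cardsT.
    by apply: proper_card; rewrite properEneq S'T subsetT.
  + by rewrite imset_eq0.
  have [/imsetP[v _ def_w] _ _] := piv_w; exists v.
  by rewrite def_w in piv_w; apply/(pivot_image F_inj (@induced_val_mono G S)).
- by rewrite cardF card_gt0.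
have imT : [set val x | x : F in setT] = S.
  apply/setP => x; apply/imsetP/idP => [[[y yS] _ ->]|xS] //.
  by exists (Sub x xS); rewrite ?inE.
by move/(pivot_image F_inj (@induced_val_mono G S)); rewrite imT; exists (val v).
Qed.

(** * Pivots and the construction *)

Lemma disjoint_path_size (F : sgraph) (a b : F) p :
  (forall z, cadj z a -> ~~ cadj z b) ->
  path (@sedge F) a p -> last a p = b -> 2 < size p.
Proof.
move=> disj; case: p => [|x [|y [|//]]] /=.
- by move=> _ eq_ab; have := disj a (cadjxx a); rewrite eq_ab cadjxx.
- by move=> /andP[ax _] eq_xb; have := disj a (cadjxx a); rewrite -eq_xb sedge_cadj.
move=> /and3P[ax xy _] eq_yb; have := disj x; rewrite cadjC sedge_cadj // => /(_ isT).
by rewrite -eq_yb sedge_cadj.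
Qed.

(** A common closed neighbour puts [a] and [b] at distance 0, 1 or 2. The bound in [is_set_dist]
    speaks of exact distances only, so the three cases are separate. *)
Lemma distance_three_disjoint (F : sgraph) (Q R : {set F}) (a b : F) :
  is_set_dist Q R 3 -> a \in Q -> b \in R -> forall z, cadj z a -> ~~ cadj z b.
Proof.
move=> [_ lbound] aQ bR z za; apply/negP => zb.
have [eq_ab|ab] := eqVneq a b.
  by suff: 3 <= 0 by []; apply: (lbound a b) => //; split=> //; exists [::].
have [adj_ab|nadj_ab] := boolP (a -- b).
  suff: 3 <= 1 by []; apply: (lbound a b) => //; split=> [|[|//] /= _ eq_ab].
    by exists [:: b]; rewrite /= adj_ab.
  by rewrite eq_ab eqxx in ab.
suff: 3 <= 2 by []; apply: (lbound a b) => //; split.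
  exists [:: z; b]; split=> //=; rewrite sedge_sym !cadj_sedge //.
    by apply: contraNneq nadj_ab => eq_zb; rewrite cadj_sedge // cadjC -eq_zb.
  by apply: contraNneq nadj_ab => eq_za; rewrite cadj_sedge // -eq_za.
case=> [|x [|//]] /= => [_ eq_ab|/andP[ax _] eq_xb]; first by rewrite eq_ab eqxx in ab.
by rewrite -eq_xb ax in nadj_ab.
Qed.

(** A pivot of the part in [F] remains one, as the part in [complete s] forms one further class with
    no neighbour in [F]. If the part in [F] is empty, [S] is a clique. *)
Lemma pivotal_union (F : sgraph) s : pivotal F -> pivotal (disjoint_union F (complete s)).
Proof.
move=> pivF S S0; pose inF (x : F) : disjoint_union F (complete s) := inl x.
have cadj_inr i j : cadj (inr i : disjoint_union F (complete s)) (inr j) by exact: orbN.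
have [S1|/pivF[v [vS twin join]]] := eqVneq [set x | inF x \in S] set0.
  have [v vS] := set0Pn _ S0; exists v.
  have univ q : q \in S -> cadj v q.
    have notinl x : inl x \notin S by have /setP/(_ x) := S1; rewrite !inE => ->.
    by case: v vS q => [x|i] + [y|j]; rewrite ?(negbTE (notinl _)).
  by split=> // q r x y qS rS xS yS; rewrite univ.
have cadj_inF x y : cadj (inF x) (inF y) = cadj x y by [].
have cadj_lr x (i : complete s) : cadj (inF x) (inr i) = false by [].
have cadj_rl x (i : complete s) :
    cadj (inr i : disjoint_union F (complete s)) (inF x) = false by [].
exists (inF v); split; first by rewrite inE in vS.
  move=> [q|i] [r|j] [x|k] [y|l] qS rS xS yS //; rewrite ?cadj_inF ?cadj_lr ?cadj_rl ?cadj_inr //.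
    by apply: twin; rewrite inE.
move=> [q|i] [r|j] [x|k] [y|l] qS rS xS yS //.
by apply: join; rewrite inE.
Qed.

(** If [S] contains the new vertex [None], that vertex is a pivot: its nonneighbours lie in the
    cliques of [C], whose closed neighbourhoods are disjoint by distance three. *)
Lemma pivotal_extension (F : sgraph) (C : {set {set F}}) :
  perfect_cliques C -> pivotal F -> pivotal (extension C).
Proof.
move=> [homC distC] pivF S S0.
pose emb (x : F) : extension C := Some x.
have emb_inj : injective emb by move=> x y [].
have emb_mono : {mono emb : x y / x -- y} by [].
have cadj_emb := cadj_mono emb_inj emb_mono.
have [NS|NS] := boolP ((None : extension C) \in S); last first.
  have defS : S = emb @: [set x | emb x \in S].
    apply/setP => z; apply/idP/imsetP => [zS|[x + ->]]; last by rewrite inE.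
    by case: z zS => [x xS|/(negP NS) //]; exists x; rewrite ?inE.
  move: S0; rewrite defS imset_eq0 => /pivF[v piv_v].
  by exists (emb v); apply/(pivot_image emb_inj emb_mono).
have farP q : ~~ cadj (None : extension C) q ->
    exists a (Q : {set F}), [/\ q = emb a, a \in Q & Q \in C].
  case: q => [a|] //; rewrite /cadj /= negbK => /bigcupP[Q QC aQ].
  by exists a, Q.
have nearP x : (None : extension C) -- x -> exists2 a, x = emb a & a \notin cover C.
  by case: x => [a|] // aC; exists a.
have twinC a b x y : a \in cover C -> b \in cover C ->
    cadj x a -> cadj x b -> cadj y a -> cadj y b.
  move=> /bigcupP[Q QC aQ] /bigcupP[R RC bR] xa xb ya.
  have [eqQR|neqQR] := eqVneq Q R; last first.
    have [dist _] := distC Q R QC RC neqQR.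
    by have := distance_three_disjoint dist aQ bR xa; rewrite xb.
  have [_ _ hom] := homC Q QC; rewrite -eqQR in bR.
  by rewrite cadjC -in_closed_nbh -(hom a b aQ bR) in_closed_nbh cadjC.
exists None; split=> //.
  move=> q r x y _ _ _ _ /farP[a [Q [-> aQ QC]]] /farP[b [R [-> bR RC]]].
  have aC : a \in cover C by apply/bigcupP; exists Q.
  have bC : b \in cover C by apply/bigcupP; exists R.
  case: x => [x|] xa; last by rewrite /cadj /= aC in xa.
  case: y => [y|] xb ya; last by rewrite /cadj /= aC in ya.
  by move: xa xb ya; rewrite -!/(emb _) !cadj_emb; apply: twinC.
move=> q r x y _ _ _ _ /farP[a [Q [-> aQ QC]]] /farP[b [R [-> bR RC]]].
move=> /nearP[x' -> x'C] /nearP[y' -> y'C]; rewrite !emb_mono => xa yb xb.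
have outer z c (T : {set F}) : T \in C -> c \in T -> z \notin cover C -> z -- c ->
    z \in outer_nbh T.
  move=> TC cT zC zc; rewrite in_setD; apply/andP; split.
    by apply: contraNN zC => zT; apply/bigcupP; exists T.
  by apply/dominatedP; exists c; rewrite // cadjC sedge_cadj.
have [eqQR|neqQR] := eqVneq Q R; last first.
  have [_ join] := distC Q R QC RC neqQR.
  by apply: join; [apply: (outer _ a)|apply: (outer _ b)].
have [_ _ hom] := homC Q QC; rewrite -eqQR in bR.
case/negP: xb; apply: cadj_sedge.
  by rewrite cadjC -in_closed_nbh -(hom a b aQ bR) in_closed_nbh cadjC sedge_cadj.
by apply: contraNneq x'C => ->; apply/bigcupP; exists Q.
Qed.

Lemma constructible_pivotal (H : sgraph) : constructible H -> pivotal H.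
Proof.
elim=> [S /set0Pn[v vS]|F s _ _|F C perfC _]; last 2 first.
- exact: pivotal_union.
- exact: pivotal_extension.
exists v; have univ (x y : complete 1) : cadj x y by rewrite /cadj (ord1 x) (ord1 y) eqxx.
by split=> // q r x y _ _ _ _; rewrite univ.
Qed.

Section Embeddable.
Variable G : sgraph.

(** Obtainability of the subgraph induced by [S], phrased with an embedding onto [S] so that the
    induction stays inside [G]. *)
Definition buildable (S : {set G}) : Prop :=
  exists2 H : sgraph, constructible H &
  exists g : H -> G, [/\ injective g, {mono g : x y / x -- y} & g @: setT = S].

Lemma buildable_set1 v : buildable [set v].
Proof.
exists (complete 1); first exact: constructible_K1.
exists (fun _ => v); split=> [x y _|x y|].
- by rewrite (ord1 x) (ord1 y).
- by rewrite (ord1 x) (ord1 y) !sedge_irr.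
by apply/setP => x; rewrite inE; apply/imsetP/eqP => [[]|->] //; exists ord0.
Qed.

Lemma buildable_union (S Q : {set G}) : Q != set0 -> [disjoint S & Q] ->
  {in Q &, forall x y, cadj x y} -> {in S & Q, forall x y, ~~ x -- y} ->
  buildable S -> buildable (S :|: Q).
Proof.
move=> Q0 /pred0P disjSQ Qclique SQ [H consH [g [g_inj g_mono gS]]].
have inS h : g h \in S by rewrite -gS imset_f.
have Q_gt0 : 0 < #|Q| by rewrite card_gt0.
exists (disjoint_union H (complete #|Q|)); first exact: constructible_union.
pose e (i : complete #|Q|) : G := enum_val i.
have eQ i : e i \in Q by apply: enum_valP.
have disj h i : g h != e i.
  by apply: contraFneq (disjSQ (g h)) => eq_ge /=; rewrite inS eq_ge eQ.
exists (fun z => match z with inl h => g h | inr i => e i end); split.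
- move=> [h|i] [h'|j] eq_z; first by rewrite (g_inj _ _ eq_z).
  + by have := disj h j; rewrite eq_z eqxx.
  + by have := disj h' i; rewrite eq_z eqxx.
  by rewrite (enum_val_inj eq_z).
- move=> [h|i] [h'|j]; first exact: g_mono.
  + by apply: negbTE; apply: SQ.
  + by apply: negbTE; rewrite sedge_sym; apply: SQ.
  apply/idP/idP => [|ij]; first by apply: contraTneq => ->; rewrite sedge_irr.
  by apply: cadj_sedge; rewrite ?Qclique // (inj_eq enum_val_inj).
apply/setP => x; rewrite in_setU; apply/imsetP/orP => [[[h|i] _ ->]|].
- by left.
- by right.
case=> [|xQ]; first by rewrite -gS => /imsetP[h _ ->]; exists (inl h).
by exists (inr (enum_rank_in xQ x)); rewrite // /e enum_rankK_in.
Qed.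

(** The classes of [v], pulled back along [g], form the perfect set of cliques. Twins give
    homogeneity and the join condition gives adjacency; attachment of every class to the
    neighbourhood of [v] makes the distances finite. *)
Lemma buildable_extension (S : {set G}) (v : G) : pivot S v ->
  (forall q, q \in S -> ~~ cadj v q -> exists x, [/\ x \in S, v -- x & x -- q]) ->
  buildable (S :\ v) -> buildable S.
Proof.
move=> piv near [H consH [g [g_inj g_mono gS]]]; have [vS twin join] := piv.
have g_cadj := cadj_mono g_inj g_mono.
have gP h : g h \in S /\ g h != v.
  have : g h \in S :\ v by rewrite -gS imset_f.
  by case/setD1P.
have gSh h : g h \in S by case: (gP h).
have g_onto x : x \in S -> x != v -> exists h, x = g h.
  by move=> xS xv; have: x \in S :\ v; [apply/setD1P|rewrite -gS => /imsetP[h _ ->]; exists h].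
have edge_v x : cadj v x -> x != v -> v -- x.
  by move=> vx xv; apply: cadj_sedge; rewrite // eq_sym.
have nonv q : ~~ cadj v q -> q != v by apply: contraNneq => ->; apply: cadjxx.
pose Q q : {set H} := [set h | ~~ cadj v (g h) && cadj (g h) q].
pose C : {set {set H}} := [set Q q | q in [set q in S | ~~ cadj v q]].
have inQ q h : (h \in Q q) = ~~ cadj v (g h) && cadj (g h) q by rewrite inE.
have CP T : T \in C -> exists q, [/\ T = Q q, q \in S & ~~ cadj v q].
  by case/imsetP => q; rewrite inE => /andP[qS vq] ->; exists q.
have Q_twin q h : q \in S -> ~~ cadj v q -> h \in Q q -> {in S, forall y, cadj y (g h) = cadj y q}.
  move=> qS vq; rewrite inQ => /andP[vh hq].
  by apply: (pivot_twins piv _ qS (gSh h)); rewrite ?cadjxx.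
have coverC h : (h \in cover C) = ~~ cadj v (g h).
  apply/bigcupP/idP => [[T /CP[q [-> _ _]]]|vh]; first by rewrite inQ => /andP[].
  exists (Q (g h)); last by rewrite inQ vh cadjxx.
  by apply: imset_f; rewrite inE gSh.
have disjQ q r z : q \in S -> r \in S -> ~~ cadj v q -> ~~ cadj v r -> Q q != Q r ->
    z \in S -> cadj z q -> ~~ cadj z r.
  move=> qS rS vq vr neq zS zq; apply: contraNN neq => zr; apply/eqP/setP => h.
  by rewrite !inQ (pivot_twins piv qS rS zS).
have perfC : perfect_cliques C.
  split=> [_ /CP[q [-> qS vq]]|_ _ /CP[q [-> qS vq]] /CP[r [-> rS vr]] neq_qr].
    have twins u w : u \in Q q -> w \in Q q -> forall y, cadj y u = cadj y w.
      by move=> uQ wQ y; rewrite -!g_cadj !(Q_twin q).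
    split.
    - have [h def_q] := g_onto q qS (nonv q vq).
      by apply/set0Pn; exists h; rewrite inQ -def_q vq cadjxx.
    - by move=> u w uQ wQ; apply: cadj_sedge; rewrite -(twins u w) ?cadjxx.
    by move=> u w uQ wQ; apply/setP => y; rewrite !in_closed_nbh ![cadj _ y]cadjC (twins u w).
  have disj a b : a \in Q q -> b \in Q r -> forall z, cadj z a -> ~~ cadj z b.
    move=> aQ bR z; rewrite -!g_cadj (Q_twin q) // (Q_twin r) //.
    exact: disjQ.
  have outer z t : t \in S -> ~~ cadj v t -> z \in outer_nbh (Q t) -> v -- g z /\ cadj (g z) t.
    move=> tS vt; rewrite in_setD => /andP[zQ /dominatedP[b bQ bz]].
    have zt : cadj (g z) t by rewrite -(Q_twin t b) // g_cadj cadjC.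
    split=> //; move: zQ; rewrite inQ zt andbT negbK => vz.
    by case: (gP z) => _; apply: edge_v.
  have joined x y : v -- g x -> v -- g y -> cadj (g x) q -> cadj (g y) r -> x -- y.
    move=> vx vy xq yr; rewrite -g_mono.
    have edge_to z t : v -- g z -> ~~ cadj v t -> cadj (g z) t -> g z -- t.
      by move=> vz vt zt; apply: cadj_sedge => //; apply: contraNneq vt => <-; apply: sedge_cadj.
    apply: (join q r) => //; try exact: edge_to.
    by apply: contraNN (disjQ q r (g x) qS rS vq vr neq_qr (gSh x) xq); apply: sedge_cadj.
  split; last first.
    by move=> x y /(outer x q qS vq)[vx xq] /(outer y r rS vr)[vy yr]; apply: joined.
  have path3 p a b : a \in Q q -> b \in Q r -> path (@sedge H) a p -> last a p = b -> 2 < size p.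
    by move=> aQ bR; apply: disjoint_path_size; apply: disj.
  split; last first.
    by move=> a b d aQ bR [[p [ab_p last_p <-]] _]; apply: (path3 p a b).
  have [hq def_q] := g_onto q qS (nonv q vq).
  have [hr def_r] := g_onto r rS (nonv r vr).
  have hqQ : hq \in Q q by rewrite inQ -def_q vq cadjxx.
  have hrQ : hr \in Q r by rewrite inQ -def_r vr cadjxx.
  have [x [xS vx xq]] := near q qS vq; have [y [yS vy yr]] := near r rS vr.
  have v_neq z : v -- z -> z != v by apply: contraTneq => ->; rewrite sedge_irr.
  have [hx def_x] := g_onto x xS (v_neq x vx).
  have [hy def_y] := g_onto y yS (v_neq y vy).
  exists hq, hr; split=> //; split=> [|p]; last exact: path3.
  (* The path of length three passes through two neighbours of [v], adjacent by the join
     condition. *)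
  exists [:: hx; hy; hr]; split=> //=.
  rewrite (joined hx hy) -?def_x -?def_y ?sedge_cadj // andbT -!g_mono -def_x -def_y.
  by rewrite sedge_sym -def_q -def_r xq.
exists (extension C); first exact: constructible_extension.
exists (fun z => if z is Some h then g h else v); split.
- move=> [h|] [h'|] //= eq_z; first by rewrite (g_inj _ _ eq_z).
    by case: (gP h); rewrite eq_z eqxx.
  by case: (gP h'); rewrite -eq_z eqxx.
- have adj_v h : v -- g h = (h \notin cover C).
    rewrite coverC negbK; apply/idP/idP => [|vh]; first exact: sedge_cadj.
    by case: (gP h) => _; apply: edge_v.
  move=> [h|] [h'|] /=; [exact: g_mono|by rewrite sedge_sym|exact: adj_v|exact: sedge_irr].
apply/setP => x; apply/imsetP/idP => [[[h|] _ ->] //|xS].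
have [->|/(g_onto x xS)[h ->]] := eqVneq x v; first by exists None.
by exists (Some h).
Qed.

(** If some nonneighbour [q] of the pivot has no neighbour in the neighbourhood of [v], its class is
    a clique component and is split off by a union. Otherwise [v] is the last vertex added, by an
    extension. *)
Lemma pivotal_buildable : pivotal G -> forall S : {set G}, S != set0 -> buildable S.
Proof.
move=> pivG S; have [n] := ubnP #|S|; elim: n S => // n IHn S; rewrite ltnS => leS S0.
have [v piv] := pivG S S0; have [vS twin join] := piv.
have [Sv|Sv] := eqVneq (S :\ v) set0.
  by rewrite -(setD1K vS) Sv setU0; apply: buildable_set1.
have [/existsP[q /and3P[qS vq far]]|/existsPn near] := boolP [exists q,
  [&& q \in S, ~~ cadj v q & [forall x, (x \in S) && (v -- x) ==> ~~ x -- q]]]; last first.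
  apply: (buildable_extension piv); last first.
    apply: IHn => //; apply: leq_trans leS.
    by rewrite (cardsD1 v S) vS.
  move=> q qS vq; have := near q; rewrite qS vq /= => /forallPn[x].
  by rewrite negb_imply negbK => /andP[/andP[xS vx] xq]; exists x.
pose Q := [set x in S | cadj x q].
have QP x : x \in Q -> [/\ x \in S, cadj x q & ~~ cadj v x].
  rewrite inE => /andP[xS xq]; split=> //.
  have [xv|xv] := eqVneq x v; first by rewrite xv in xq; rewrite xq in vq.
  apply/negP => vx; have vx' : v -- x by apply: cadj_sedge; rewrite // eq_sym.
  have := forallP far x; rewrite xS vx' /= cadj_sedge //.
  by apply: contraNneq vq => <-.
have Q_nbh x y : x \in Q -> y \in S -> cadj y x -> cadj y q.
  move=> /QP[xS xq vx] yS yx.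
  by apply: (twin x q x y); rewrite ?cadjxx.
have qQ : q \in Q by rewrite inE qS cadjxx.
have QS : Q \subset S by apply/subsetP => x /QP[].
rewrite -(setID S Q) (setIidPr QS) setUC; apply: buildable_union.
- by apply/set0Pn; exists q.
- by rewrite disjoint_sym; apply/pred0P => x /=; rewrite in_setD; case: (x \in Q).
- move=> x y /QP[xS xq vx] /QP[yS yq vy].
  by apply: (twin q y q x); rewrite ?cadjxx // cadjC.
- move=> x y; rewrite in_setD => /andP[xQ xS] yQ; apply: contraNN xQ => xy.
  by rewrite inE xS (Q_nbh y) // sedge_cadj.
apply: IHn; last first.
  by apply/set0Pn; exists v; rewrite in_setD vS andbT; apply/negP => /QP[_ _]; rewrite cadjxx.
apply: leq_trans leS; apply/proper_card/properP; split; first exact: subsetDl.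
by exists q; rewrite // in_setD qQ.
Qed.

End Embeddable.

(** * Assembling the equivalences *)

Lemma pivotal_obtainable (G : sgraph) : 0 < #|G| -> pivotal G -> obtainable G.
Proof.
move=> G0 pivG; have [|H consH [g [g_inj g_mono g_onto]]] := @pivotal_buildable G pivG setT.
  by rewrite -card_gt0 cardsT.
exists H => //; have cardGH : #|G| <= #|H| by rewrite -cardsT -g_onto -cardsT leq_imset_card.
have [f fK gK] := inj_card_bij g_inj cardGH.
by exists f; split; [exists g|move=> x y; rewrite -g_mono !gK].
Qed.

Lemma obtainable_pivotal (G : sgraph) : obtainable G -> pivotal G.
Proof.
move=> [H /constructible_pivotal pivH [f [/bij_inj f_inj f_mono]]].
exact: pivotal_embedding f_inj f_mono pivH.
Qed.

Lemma pivotal_gg_perfect (G : sgraph) : pivotal G -> gg_perfect G.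
Proof.
move=> pivG S /set0Pn[x xS]; apply: pivotal_game.
  by apply/card_gt0P; exists (Sub x xS).
exact: pivotal_embedding (@induced_val_inj G S) (@induced_val_mono G S) pivG.
Qed.

Lemma gg_perfect_two (G : sgraph) : gg_perfect G -> two_gg_perfect G.
Proof. by move=> perfG S S0 <-; apply: perfG. Qed.

Theorem theorem3p7 (G : sgraph) (G_nonempty : 0 < #|G|) :
  (gg_perfect G <-> two_gg_perfect G) /\ (two_gg_perfect G <-> obtainable G).
Proof.
have two_pivotal : two_gg_perfect G -> pivotal G.
  by move=> /two_gg_perfect_pair_centered/pair_centered_pivotal.
split; split.
- exact: gg_perfect_two.
- by move/two_pivotal/pivotal_gg_perfect.
- by move/two_pivotal/pivotal_obtainable; apply.
by move/obtainable_pivotal/pivotal_gg_perfect/gg_perfect_two.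
Qed.
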